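(* Let $\Gamma$ be a digraphon on a probability space $(\Omega,\mu)$. Then there exist a finite or countable set $I$ not containing $0$ and a decomposition $\Omega=X_0\sqcup\bigsqcup_{i\in I}X_i$ such that $X_0$ is either an empty set or is fragmented in $\Gamma$, and each $X_i$ ($i\in I$) is a strong component in $\Gamma$. Further, this decomposition is unique in the following sense: if $\{X_i\}_{i\in I\cup\{0\}}$ and $\{X'_i\}_{i\in I'\cup\{0\}}$ are two such decompositions for $\Gamma$, then there exists a bijection $\pi:I\to I'$ such that $X'_{\pi(i)}$ equals $X_i$ modulo a nullset for each $i\in I$, and $X_0$ equals $X'_0$ modulo a nullset.
   Context: All subsets of $\Omega$ are assumed measurable. A digraphon on a probability space $(\Omega,\mu)$ is a measurable function $\Gamma:\Omega^2\to[0,1]$ (not necessarily symmetric). Let $X\subseteq\Omega$ have positive measure. (1) $X$ is strongly connected in $\Gamma$ if for every partition $A\sqcup B=X$ with $\mu(A),\mu(B)>0$ we have $\int_{A\times B}\Gamma>0$. (2) $X$ is a strong component in $\Gamma$ if $X$ is strongly connected in $\Gamma$ and every $Y\subseteq\Omega$ with $\mu(X\cap Y)>0$ and $\mu(Y\setminus X)>0$ is not strongly connected in $\Gamma$. (3) $X$ is fragmented in $\Gamma$ if every subset $Y\subseteq X$ of positive measure is not strongly connected in $\Gamma$. In the uniqueness part, ''empty'' for the part $X_0$ is understood modulo nullsets. *)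

(* Defs.v *)
From HB Require Import structures.
From mathcomp Require Import all_boot all_order all_algebra.
From mathcomp Require Import all_classical all_reals all_analysis.

Set Implicit Arguments.
Unset Strict Implicit.
Unset Printing Implicit Defensive.

Import Order.TTheory GRing.Theory Num.Theory.

Local Open Scope classical_set_scope.
Local Open Scope ring_scope.

Section Digraphons.
Context (d : measure_display) (T : measurableType d) (R : realType).
Variables (mu : probability T R) (Gamma : T * T -> R).

(* T * T carries the product sigma-algebra. *)
Definition is_digraphon : Prop :=
  measurable_fun [set: T * T] Gamma /\ forall z, 0 <= Gamma z <= 1.

Definition strongly_connected (X : set T) : Prop :=
  [/\ measurable X, (0 < mu X)%E &
    forall A B : set T, measurable A -> measurable B ->
      A `|` B = X -> A `&` B = set0 -> (0 < mu A)%E -> (0 < mu B)%E ->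
      (0 < \int[mu \x mu]_(z in A `*` B) (Gamma z)%:E)%E].

Definition strong_component (X : set T) : Prop :=
  strongly_connected X /\
  forall Y : set T, measurable Y ->
    (0 < mu (X `&` Y))%E -> (0 < mu (Y `\` X))%E -> ~ strongly_connected Y.

Definition fragmented (X : set T) : Prop :=
  [/\ measurable X, (0 < mu X)%E &
    forall Y : set T, measurable Y -> Y `<=` X -> (0 < mu Y)%E ->
      ~ strongly_connected Y].

(* [o] plays the role of the index 0, and J is an ambient type for the index
   set I.  The predicate E says which sets count as empty for X o: only set0,
   or every nullset.  The library's [partition] is not used because it forbids
   empty parts. *)
Definition component_decomposition (E : set (set T))
    (J : Type) (o : J) (I : set J) (X : J -> set T) : Prop :=
  [/\ countable I /\ ~ I o,
      cover (o |` I) X = [set: T] /\ trivIset (o |` I) X,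
      measurable (X o) /\ (E (X o) \/ fragmented (X o)) &
      forall i, I i -> strong_component (X i)].

Definition nullset : set (set T) := [set A | measurable A /\ mu A = 0%E].

Definition eq_mod_null (A B : set T) : Prop := nullset (A `+` B).

End Digraphons.

(* Main.v *)
Require Import Defs.
From HB Require Import structures.
From mathcomp Require Import all_boot all_order all_algebra.
From mathcomp Require Import all_classical all_reals all_analysis.
From mathcomp Require Import measurable_realfun.

(** Strongly connected sets behave like connected subsets of a space, with
    overlap in positive measure in place of a common point. If the weight from
    [A] to [B] vanishes and [X] is covered by [A] and [B] up to a nullset, then
    [X] lies on one side of the split up to a nullset ([connected_split]).
    Hence countably many strongly connected sets that all overlap one of them
    in positive measure have a strongly connected union ([connected_glue]).

    Since [mu] is finite, a class of sets closed under countable unions has a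
    member that is largest up to a nullset ([exhaustion]). Among the strongly
    connected supersets of a given strongly connected set, this largest member
    is a strong component by gluing ([component_exists]). Among the countable
    unions of strong components, the complement of the largest one contains no
    strongly connected set of positive measure ([components_cover_connected]).

    Two components either are disjoint up to a nullset or agree up to one
    ([components_eq_mod_null]). Disjointifying the components in that largest
    union and dropping the null parts therefore changes the remaining
    components only by nullsets, and yields a decomposition whose remainder is
    null or fragmented; a null remainder is merged into a component
    ([decomposition_exists]).

    For uniqueness, a component of one decomposition cannot be almost contained
    in the remainder of the other, so it overlaps one of its components
    ([component_meets_part]), hence equals it up to a nullset, and overlaps no
    further one ([component_meets_one_part]). This gives the bijection, and the
    remainders agree because the components do. *)

Local Open Scope classical_set_scope.

(** * Sets up to nullsets *)

Section Negligible.
Import Order.TTheory GRing.Theory Num.Theory.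
Set Implicit Arguments.
Unset Strict Implicit.
Local Open Scope ring_scope.
Context {d : measure_display} {T : measurableType d} {R : realType}.

Lemma measure_gt0P (mu : {measure set T -> \bar R}) (A : set T) :
  measurable A -> (0 < mu A)%E <-> ~ mu.-negligible A.
Proof.
move=> mA; rewrite lt0e measure_ge0 andbT negligibleP //.
by split=> [/eqP|/eqP].
Qed.

Lemma negligible_bigcup_countable (mu : {measure set T -> \bar R})
    (J : Type) (I : set J) (F : J -> set T) :
  countable I -> (forall i, I i -> mu.-negligible (F i)) ->
  mu.-negligible (\bigcup_(i in I) F i).
Proof.
move=> /countable_injP[f finj] nullF.
apply: (@negligibleS _ _ _ _
    (\bigcup_n \bigcup_(i in [set i | I i /\ f i = n]) F i)).
  by move=> x [i Ii Fix]; exists (f i) => //; exists i.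
apply: negligible_bigcup => n.
have [[i [Ii fin]]|none] := pselect (exists i, I i /\ f i = n); last first.
  rewrite bigcup0; first exact: negligible_set0.
  by move=> i [Ii fin]; exfalso; apply: none; exists i.
apply: negligibleS (nullF i Ii) => x [j [Ij fjn]] Fjx.
by rewrite (finj i j) ?inE// fin.
Qed.

Lemma bigcup_head (A B : set T) :
  \bigcup_n (if n is 0%N then A else B) = A `|` B.
Proof.
apply/seteqP; split=> [x [[|n] _]|x []]; first by left.
- by right.
- by exists 0%N.
- by exists 1%N.
Qed.

(** Exhaustion: the supremum of the measures of the members is attained on
    the union of a maximizing sequence, and adjoining a further member to that
    union cannot increase its measure. *)
Lemma exhaustion (mu : {finite_measure set T -> \bar R}) (P : set (set T)) :
  P !=set0 -> P `<=` measurable ->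
  (forall F : (set T)^nat, (forall n, P (F n)) -> P (\bigcup_n F n)) ->
  exists2 M, P M & forall Z, P Z -> mu.-negligible (Z `\` M).
Proof.
move=> [P0 PP0] Pmeas Pcup.
pose E := [set fine (mu Z) | Z in P].
have muE Z : P Z -> mu Z = (fine (mu Z))%:E.
  by move=> PZ; rewrite fineK// fin_num_measure//; exact: Pmeas.
have supE : has_sup E.
  split; first by exists (fine (mu P0)), P0.
  exists (fine (mu setT)) => _ [Z PZ <-].
  rewrite -lee_fin -muE// fineK; last by rewrite fin_num_measure.
  by apply: le_measure => //; rewrite inE//; exact: Pmeas.
have /choice[F F_] n : exists Z,
    P Z /\ (sup E - n.+1%:R^-1 < fine (mu Z))%R.
  have [|_ [Z PZ <-] ltZ] := @sup_adherent _ E n.+1%:R^-1 _ supE.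
    by rewrite invr_gt0.
  by exists Z.
have PM : P (\bigcup_n F n) by apply: Pcup => n; have [] := F_ n.
exists (\bigcup_n F n) => // Z PZ.
set M := \bigcup_n F n in PM *.
have PMZ : P (M `|` Z).
  by rewrite -bigcup_head; apply: Pcup => -[|n].
have supM : sup E <= fine (mu M).
  apply/ler_addgt0Pl => e e0.
  have [n /ltW ltne] : exists n, n.+1%:R^-1 < e.
    have [n nP] := ltr_add_invr e0.
    by exists n; move: nP; rewrite add0r.
  have [PFn /ltW ltFn] := F_ n.
  rewrite -lerBlDl; apply: le_trans (_ : fine (mu (F n)) <= _).
    by apply: le_trans ltFn; rewrite lerD2l lerN2.
  rewrite -lee_fin -!muE//; apply: le_measure; rewrite ?inE; try exact: Pmeas.
  exact: bigcup_sup.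
have leMZ : (mu (M `|` Z) <= mu M)%E.
  rewrite muE// [leRHS]muE// lee_fin; apply: le_trans supM.
  by apply: ub_le_sup; [case: supE|exists (M `|` Z)].
have mM := Pmeas _ PM; have mZ := Pmeas _ PZ.
apply/negligibleP; first exact: measurableD.
apply/eqP; rewrite eq_le measure_ge0 andbT.
rewrite -(leeD2lE (x := mu M)) ?fin_num_measure//.
rewrite adde0 -measureU ?setUDr ?setDv ?setD0//; first exact: measurableD.
by apply/seteqP; split=> // x [? []].
Qed.

End Negligible.

(** * Gluing strongly connected sets *)

Section Connected.
Import Order.TTheory GRing.Theory Num.Theory.
Set Implicit Arguments.
Unset Strict Implicit.
Local Open Scope ring_scope.
Context {d : measure_display} {T : measurableType d} {R : realType}.
Variables (mu : probability T R) (Gamma : T * T -> R).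
Hypothesis hGamma : is_digraphon Gamma.

Local Notation null := mu.-negligible.
Local Notation connected := (strongly_connected mu Gamma).
Local Notation component := (strong_component mu Gamma).
Local Notation weight A B := (\int[mu \x mu]_(z in A `*` B) (Gamma z)%:E)%E.

Lemma measurable_digraphon (A : set (T * T)) :
  measurable_fun A (fun z => (Gamma z)%:E).
Proof.
apply/measurable_EFinP; exact: measurable_funS hGamma.1.
Qed.

Lemma le_weight (A B : set (T * T)) : measurable A -> measurable B ->
  A `<=` B ->
  (\int[mu \x mu]_(z in A) (Gamma z)%:E <=
   \int[mu \x mu]_(z in B) (Gamma z)%:E)%E.
Proof.
move=> mA mB AB; apply: ge0_subset_integral => //.
  exact: measurable_digraphon.
by move=> z _; rewrite lee_fin; case/andP: (hGamma.2 z).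
Qed.

Lemma weight_ge0 (A : set (T * T)) :
  (0 <= \int[mu \x mu]_(z in A) (Gamma z)%:E)%E.
Proof.
by apply: integral_ge0 => z _; rewrite lee_fin; case/andP: (hGamma.2 z).
Qed.

Lemma weight_null (A N : set T) : measurable A -> measurable N -> null N ->
  weight A N = 0%E.
Proof.
move=> mA mN nN; apply: null_set_integral.
- exact: measurableX.
- exact: measurable_digraphon.
- apply: etrans (product_measure1E _ _ mA mN) _.
  by rewrite (measure_negligible mN nN) mule0.
Qed.

(** Otherwise [X `&` A], [X `\` A] would be a partition of [X] into sets of
    positive measure. The weight between them is zero because [X `\` A] is
    contained in [B] up to a nullset. *)
Lemma connected_split (X A B : set T) :
  connected X -> measurable A -> measurable B -> null (X `\` (A `|` B)) ->
  weight A B = 0%E -> null (X `&` A) \/ null (X `\` A).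
Proof.
move=> [mX _ Xconn] mA mB nXAB w0.
have [nA|/measure_gt0P pA] := pselect (null (X `&` A)); first by left.
have [nD|/measure_gt0P pD] := pselect (null (X `\` A)); first by right.
have mXA : measurable (X `&` A) by exact: measurableI.
have mXD : measurable (X `\` A) by exact: measurableD.
have mN : measurable (X `\` (A `|` B)).
  by apply: measurableD => //; exact: measurableU.
have := Xconn _ _ mXA mXD _ _ (pA mXA) (pD mXD).
rewrite setUIDK => /(_ erefl).
rewrite setIDA setIAC -setIDA setDv setI0 => /(_ erefl) w1; exfalso.
have mXB : measurable ((X `&` B) `\` A).
  by apply: measurableD => //; exact: measurableI.
have splitX : (X `&` A) `*` (X `\` A) =
    (X `&` A) `*` ((X `&` B) `\` A) `|` (X `&` A) `*` (X `\` (A `|` B)).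
  by apply/seteqP; split=> -[x y] /=; have := EM (B y); tauto.
move: w1; rewrite splitX ge0_integral_setU.
- rewrite (weight_null mXA mN nXAB)// adde0 ltNge -w0.
  rewrite le_weight//; try exact: measurableX.
  by move=> [x y] [[_ Ax] [[_ By] _]].
- exact: measurableX.
- exact: measurableX.
- exact: measurable_digraphon.
- by move=> z _; rewrite lee_fin; case/andP: (hGamma.2 z).
- by apply/disj_setPLR => -[x y] [_ [[_ By] _]] [_ [_]]; apply; right.
Qed.

(** A zero-weight split of [Y] leaves each [F n] on one side up to a nullset.
    Overlapping [F 0] in positive measure forces every [F n] onto the side of
    [F 0], and the other side of the split is then null. *)
Lemma connected_glue (F : (set T)^nat) (Y : set T) :
  measurable Y -> (forall n, connected (F n)) ->
  (forall n, ~ null (F n `&` F 0%N)) ->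
  (forall n, null (F n `\` Y)) -> null (Y `\` \bigcup_n F n) ->
  connected Y.
Proof.
move=> mY Fconn Fmeet FY YF; split=> //.
  apply/measure_gt0P => // nY; apply: (Fmeet 0%N).
  apply: negligibleS (negligibleU nY (FY 0%N)) => x [Fx _] /=.
  have := EM (Y x); tauto.
move=> A B mA mB AB AB0 /measure_gt0P pA /measure_gt0P pB.
rewrite lt0e weight_ge0 andbT; apply/eqP => w0.
have disjAB x : A x -> B x -> False.
  by move=> Ax Bx; rewrite -[False]/(set0 x) -AB0.
have side n : null (F n `&` A) \/ null (F n `\` A).
  by apply: connected_split (Fconn n) mA mB _ w0; rewrite AB.
have [F0A|F0A] := side 0%N.
  have FA n : null (F n `&` A).
    have [//|FnA] := side n; exfalso; apply: (Fmeet n).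
    apply: negligibleS (negligibleU FnA F0A) => x [Fnx F0x] /=.
    have := EM (A x); tauto.
  apply: (pA mA).
  apply: negligibleS (negligibleU YF (negligible_bigcup FA)) => x Ax.
  have [[n _ Fnx]|nFx] := pselect ((\bigcup_n F n) x).
    by right; exists n.
  by left; split=> //; rewrite -AB; left.
have FA n : null (F n `\` A).
  have [FnA|//] := side n; exfalso; apply: (Fmeet n).
  apply: negligibleS (negligibleU FnA F0A) => x [Fnx F0x] /=.
  have := EM (A x); tauto.
apply: (pB mB).
apply: negligibleS (negligibleU YF (negligible_bigcup FA)) => x Bx.
have [[n _ Fnx]|nFx] := pselect ((\bigcup_n F n) x).
  by right; exists n => //; split=> // Ax; exact: disjAB Ax Bx.
by left; split=> //; rewrite -AB; right.
Qed.

Lemma connected_meas (X : set T) : connected X -> measurable X.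
Proof. by case. Qed.

Lemma connected_nonnull (X : set T) : connected X -> ~ null X.
Proof. by move=> [mX pX _]; apply/measure_gt0P. Qed.

Lemma connected_mod_null (X Y : set T) : connected X -> measurable Y ->
  null (X `\` Y) -> null (Y `\` X) -> connected Y.
Proof.
move=> Xconn mY nXY nYX; apply: (@connected_glue (fun=> X)) => //.
- by move=> _; rewrite setIid; exact: connected_nonnull.
- by apply: negligibleS nYX; apply: setDS; exact: (bigcup_sup (i := 0%N)).
Qed.

Lemma connectedU (X Y : set T) : connected X -> connected Y ->
  ~ null (X `&` Y) -> connected (X `|` Y).
Proof.
move=> Xconn Yconn XY.
have [mX mY] := (connected_meas Xconn, connected_meas Yconn).
have XUY := bigcup_head X Y.
apply: (@connected_glue (fun n => if n is 0%N then X else Y)).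
- exact: measurableU.
- by case.
- move=> [|n]; last by rewrite setIC.
  by rewrite setIid; exact: connected_nonnull.
- move=> n; rewrite -XUY setDE; apply: negligibleS (negligible_set0 _).
  by move=> x [Fx]; apply; exists n.
- by rewrite XUY setDv; exact: negligible_set0.
Qed.

Lemma connected_bigcup (X : set T) (F : (set T)^nat) : connected X ->
  (forall n, connected (F n) /\ X `<=` F n) -> connected (\bigcup_n F n).
Proof.
move=> Xconn F_; apply: (@connected_glue F).
- by apply: bigcup_measurable => n _; apply: connected_meas; exact: (F_ n).1.
- by move=> n; exact: (F_ n).1.
- move=> n nF; apply: (connected_nonnull Xconn).
  by apply: negligibleS nF => x Xx; split; apply: (F_ _).2.
- move=> n; apply: negligibleS (negligible_set0 _).
  by move=> x [Fx]; apply; exists n.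
- by rewrite setDv; exact: negligible_set0.
Qed.

(** * Strong components *)

Lemma component_absorbs (C Z : set T) : component C -> connected Z ->
  ~ null (C `&` Z) -> null (Z `\` C).
Proof.
move=> [Cconn Cmax] Zconn CZ; apply: contrapT => ZC.
have [mC mZ] := (connected_meas Cconn, connected_meas Zconn).
apply: (Cmax Z) => //; apply/measure_gt0P => //.
  exact: measurableI.
exact: measurableD.
Qed.

Lemma component_mod_null (C D : set T) : component C -> measurable D ->
  null (C `\` D) -> null (D `\` C) -> component D.
Proof.
move=> Ccomp mD nCD nDC; have Cconn := Ccomp.1; split.
  exact: connected_mod_null Cconn mD nCD nDC.
move=> Y mY /measure_gt0P pDY /measure_gt0P pYD Yconn.
apply: pYD; first exact: measurableD.
have CY : ~ null (C `&` Y).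
  move=> nCY; apply: pDY; first exact: measurableI.
  apply: negligibleS (negligibleU nCY nDC) => x [Dx Yx] /=.
  have := EM (C x); tauto.
apply: negligibleS (negligibleU (component_absorbs Ccomp Yconn CY) nCD).
by move=> x [Yx nDx] /=; have := EM (C x); tauto.
Qed.

(** A largest connected superset of [X] is a component: a connected set that
    meets it in positive measure can be glued to it. *)
Lemma component_exists (X : set T) : connected X ->
  exists2 C, X `<=` C & component C.
Proof.
move=> Xconn; pose P := [set Z | connected Z /\ X `<=` Z].
have [||| C [Cconn XC] Cmax] := @exhaustion _ _ _ mu P.
- by exists X; split.
- by move=> Z [/connected_meas].
- move=> F PF; split; first exact: connected_bigcup PF.
  exact: subset_trans (PF 0%N).2 (bigcup_sup _).
exists C => //; split=> // Y mY /measure_gt0P pCY /measure_gt0P pYC Yconn.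
have mC := connected_meas Cconn.
apply: pYC; first exact: measurableD.
have [|] := Cmax (C `|` Y) _; last first.
  move=> N [mN N0 CYN]; exists N; split=> //; apply: subset_trans CYN.
  by apply: setSD => x; right.
split; last by move=> x /XC; left.
by apply: connectedU => //; apply: pCY; exact: measurableI.
Qed.

Lemma components_eq_mod_null (C D : set T) : component C -> component D ->
  ~ null (C `&` D) -> null (C `\` D) /\ null (D `\` C).
Proof.
move=> Ccomp Dcomp CD; split; apply: component_absorbs => //.
- exact: Ccomp.1.
- by rewrite setIC.
- exact: Dcomp.1.
Qed.

(** * Existence of the decomposition *)

(** Admitting the empty set lets a finite or empty family of components be
    listed as a sequence. *)
Definition component_or_empty (C : set T) := C = set0 \/ component C.

Lemma component_or_empty_meas (C : set T) :
  component_or_empty C -> measurable C.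
Proof. by move=> [->//|[/connected_meas]]. Qed.

(** Countable unions of components are closed under countable unions, so one
    of them, [\bigcup_n C n], is largest up to a nullset. Every connected set
    lies in a component, and that component cannot enlarge the union. *)
Lemma components_cover_connected : exists C : (set T)^nat,
  (forall n, component_or_empty (C n)) /\
  forall X, connected X -> null (X `\` \bigcup_n C n).
Proof.
pose P := [set U | exists2 C : (set T)^nat,
  (forall n, component_or_empty (C n)) & U = \bigcup_n C n].
have [||| U [C C_ ->] Cmax] := @exhaustion _ _ _ mu P.
- by exists (\bigcup_(n : nat) set0), (fun=> set0) => // n; left.
- move=> _ [C C_ ->]; apply: bigcup_measurable => n _.
  exact: component_or_empty_meas.
- move=> F PF.
  have /choice[C C_] n : exists C : (set T)^nat,
      (forall m, component_or_empty (C m)) /\ F n = \bigcup_m C m.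
    by have [C ? ?] := PF n; exists C.
  exists (fun k => if unpickle k is Some nm then C nm.1 nm.2 else set0).
    by move=> k; case: unpickle => [nm|]; [exact: (C_ nm.1).1|left].
  apply/seteqP; split=> x [k _].
    rewrite (C_ k).2 => -[m _ Cx].
    by exists (pickle (k, m)) => //; rewrite pickleK.
  case: unpickle => [[n m] /= Cx|//]; exists n => //.
  by rewrite (C_ n).2; exists m.
exists C; split=> // X Xconn.
have [Y XY Ycomp] := component_exists Xconn.
have : null (Y `\` \bigcup_n C n).
  apply: Cmax; exists (fun=> Y); first by move=> _; right.
  by rewrite bigcup_const//; exists 0%N.
by apply: negligibleS; exact: setSD.
Qed.

(** For sets [C n] that are pairwise almost equal or almost disjoint, [seqDU C]
    changes the first set of each class by a nullset and makes the later ones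
    null, so discarding its null terms keeps one set per class. *)
Lemma decomposition_exists_mod_null : exists (I : set nat) (X : nat -> set T),
  component_decomposition mu Gamma (nullset mu) 0%N I X.
Proof.
have [C [C_ Ccover]] := components_cover_connected.
have mC n := component_or_empty_meas (C_ n).
pose D := seqDU C; have mD n : measurable (D n) by exact: seqDU_measurable.
pose K := [set n | ~ null (D n)].
have Dcomp n : K n -> component (D n).
  move=> Dn; have [C0|Ccomp] := C_ n.
    exfalso; apply: Dn; apply: negligibleS (negligible_set0 _).
    by rewrite -C0; exact: subset_seqDU.
  apply: (component_mod_null Ccomp) => //; last first.
    apply: negligibleS (negligible_set0 _) => x [Dx nCx].
    by exfalso; apply: nCx; exact: subset_seqDU Dx.
  (* An earlier component overlapping C n in positive measure would agree with
     C n up to a nullset, leaving D n null. *)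
  have nCC m : (m < n)%N -> null (C n `&` C m).
    move=> mn; apply: contrapT => CC; apply: Dn.
    have [Cm0|Cmcomp] := C_ m.
      by exfalso; apply: CC; rewrite Cm0 setI0; exact: negligible_set0.
    have [nCnm _] := components_eq_mod_null Ccomp Cmcomp CC.
    apply: negligibleS nCnm => x [Cx nCx]; split=> // Cmx; apply: nCx.
    by rewrite -bigcup_mkord; exists m.
  apply: (@negligibleS _ _ _ _ (\bigcup_(m in `I_n) (C n `&` C m))).
    move=> x [Cx nDx]; apply: contrapT => nx; apply: nDx; split=> //.
    by rewrite -bigcup_mkord => -[m /= mn Cmx]; apply: nx; exists m.
  by apply: negligible_bigcup_countable => // m; exact: nCC.
pose R0 := ~` \bigcup_(n in K) D n.
have mR0 : measurable R0 by apply: measurableC; exact: bigcup_measurable.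
exists [set n.+1 | n in K], (fun n => if n is m.+1 then D m else R0); split.
- by split; [|move=> [n]].
- split.
    apply/seteqP; split=> // x _.
    have [[n Kn Dx]|nx] := pselect ((\bigcup_(n in K) D n) x).
      by exists n.+1 => //; right; exists n.
    by exists 0%N => //; left.
  move=> i j [->|[n Kn <-]] [->|[m Km <-]] //= [x [ix jx]].
  - by exfalso; apply: ix; exists m.
  - by exfalso; apply: jx; exists n.
  - by congr S; apply: (trivIset_seqDU C) => //; exists x.
- split=> //=.
  have [nR0|pR0] := pselect (null R0).
    by left; split=> //; exact: measure_negligible.
  right; split=> //; first exact/measure_gt0P.
  move=> Y mY YR0 _ Yconn; apply: (connected_nonnull Yconn).
  apply: (@negligibleS _ _ _ _
      ((Y `\` \bigcup_n C n) `|` \bigcup_(n in ~` K) D n)).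
    move=> x Yx; have [|nCx] := pselect ((\bigcup_n C n) x); last by left.
    rewrite seqDU_bigcup_eq => -[n _ Dx]; right; exists n => //.
    by move=> Kn; apply: (YR0 x Yx); exists n.
  apply: negligibleU; first exact: Ccover.
  by apply: negligible_bigcup_countable => // n /contrapT.
- by move=> _ [n Kn <-]; exact: Dcomp.
Qed.

(** A null part of index 0 is merged into one of the components, which exists
    because the whole space is not null. *)
Lemma decomposition_exists : exists (I : set nat) (X : nat -> set T),
  component_decomposition mu Gamma [set set0] 0%N I X.
Proof.
have [I [X [[cI nI0] [Xcover Xtriv] [mX0 X0] Xcomp]]] :=
  decomposition_exists_mod_null.
case: X0 => [[_ X00]|X0frag]; last first.
  by exists I, X; split=> //; split=> //; right.
have nX0 : null (X 0%N) by exact/negligibleP.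
have [i Ii] : exists i, I i.
  apply: contrapT => none; have := @probability_setT _ _ _ mu.
  have -> : [set: T] = X 0%N.
    apply/seteqP; split=> // x _.
    have : (cover (0%N |` I) X) x by rewrite Xcover.
    by move=> [j [-> //|Ij] _]; exfalso; apply: none; exists j.
  by rewrite X00 => /esym/eqP; rewrite onee_eq0.
have i0 : i <> 0%N by move=> i0; apply: nI0; rewrite -i0.
have I0 j : I j -> j <> 0%N by move=> Ij j0; apply: nI0; rewrite -j0.
(* Relabelling the part 0 as i moves it into the i-th part and keeps the
   family a partition. *)
pose f k := if k == 0%N then i else k.
have fI j : I j -> f j = j by move=> /I0/eqP/negPf; rewrite /f => ->.
pose part j := [set k | (0%N |` I) k /\ f k = j].
pose X' j := \bigcup_(k in part j) X k.
exists I, X'; split=> //.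
- split.
    apply/seteqP; split=> // x _.
    have : (cover (0%N |` I) X) x by rewrite Xcover.
    move=> [k Ik Xx]; exists (f k); last by exists k.
    by right; case: Ik => [->//|Ik]; rewrite fI.
  move=> j j' _ _ [x [[k [Ik <-] Xx] [k' [Ik' <-] X'x]]].
  by congr f; apply: Xtriv => //; exists x.
- have X'0 : X' 0%N = set0.
    rewrite /X' bigcup0// => k [_]; rewrite /f.
    by case: eqP => // _ /i0.
  by split; [rewrite X'0|left].
- move=> j Ij; apply: component_mod_null (Xcomp j Ij) _ _ _.
  + apply: bigcup_measurable => k [[->//|Ik] _].
    exact: connected_meas (Xcomp k Ik).1.
  + apply: negligibleS (negligible_set0 _) => x [Xx]; apply.
    by exists j => //; split; [right|exact: fI].
  + apply: negligibleS nX0 => x [[k [[->//|Ik]]]].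
    by rewrite fI// => ->.
Qed.

(** * Uniqueness of the decomposition *)

Lemma eq_mod_nullI (A B : set T) : measurable A -> measurable B ->
  null (A `\` B) -> null (B `\` A) -> eq_mod_null mu A B.
Proof.
move=> mA mB nAB nBA.
have mD : measurable (A `+` B).
  by rewrite setY_def; apply: measurableU; exact: measurableD.
split=> //; apply: measure_negligible => //.
by rewrite setY_def; exact: negligibleU.
Qed.

Section Uniqueness.
Variables (J : Type) (o : J) (I : set J) (X : J -> set T).
Hypothesis dec : component_decomposition mu Gamma (nullset mu) o I X.

(** Otherwise [C] would lie in [X o] up to a nullset, and [X o] contains no
    connected set. *)
Lemma component_meets_part (C : set T) : component C ->
  exists2 i, I i & ~ null (C `&` X i).
Proof.
move=> Ccomp; apply: contrapT => none.
have [[cI _] [Xcover _] [mXo Xo] _] := dec.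
have Cconn := Ccomp.1; have mC := connected_meas Cconn.
have nCo : null (C `\` X o).
  apply: (@negligibleS _ _ _ _ (\bigcup_(i in I) (C `&` X i))).
    move=> x [Cx nXo]; have : (cover (o |` I) X) x by rewrite Xcover.
    by move=> [i [->//|Ii] Xx]; exists i.
  apply: negligible_bigcup_countable => // i Ii.
  by apply: contrapT => nCi; apply: none; exists i.
have mCo : measurable (C `&` X o) by exact: measurableI.
have CoC : connected (C `&` X o).
  apply: connected_mod_null Cconn mCo _ _.
    by apply: negligibleS nCo => x [Cx nx]; split=> // Xx; apply: nx.
  by apply: negligibleS (negligible_set0 _) => x [[]].
case: Xo => [[_ /negligibleP nXo]|[_ _ frag]].
  apply: (connected_nonnull CoC); apply: negligibleS (nXo mXo).
  exact: subIsetr.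
apply: (frag (C `&` X o)) => //.
by case: CoC.
Qed.

Lemma component_meets_one_part (C : set T) (i j : J) : component C ->
  I i -> I j -> ~ null (C `&` X i) -> ~ null (C `&` X j) -> i = j.
Proof.
move=> Ccomp Ii Ij Ci Cj; have [_ [_ Xtriv] _ Xcomp] := dec.
apply: Xtriv; [by right|by right|].
apply: contrapT => /set0P/negP; rewrite negbK => /eqP Xij; apply: Ci.
have nCj : null (C `\` X j).
  by apply: component_absorbs (Xcomp j Ij) Ccomp.1 _; rewrite setIC.
apply: negligibleS nCj => x [Cx Xix]; split=> // Xjx.
by rewrite -[False]/(set0 x) -Xij.
Qed.

End Uniqueness.

Section TwoDecompositions.
Variables (J J' : Type) (o : J) (o' : J') (I : set J) (I' : set J').
Variables (X : J -> set T) (X' : J' -> set T).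
Hypothesis dec : component_decomposition mu Gamma (nullset mu) o I X.
Hypothesis dec' : component_decomposition mu Gamma (nullset mu) o' I' X'.

(** A component of the second decomposition almost equals one of the first,
    which is disjoint from [X o]. *)
Lemma remainder_sub_mod_null : null (X o `\` X' o').
Proof.
have [[_ nIo] [_ Xtriv] _ Xcomp] := dec.
have [[cI' _] [X'cover _] _ X'comp] := dec'.
apply: (@negligibleS _ _ _ _ (\bigcup_(j in I') (X o `&` X' j))).
  move=> x [Xox nx]; have : (cover (o' |` I') X') x by rewrite X'cover.
  by move=> [j [->//|I'j] Xx]; exists j.
apply: negligible_bigcup_countable => // j I'j.
have [i Ii Cji] := component_meets_part dec (X'comp j I'j).
have nji : null (X' j `\` X i).
  by apply: component_absorbs (Xcomp i Ii) (X'comp j I'j).1 _; rewrite setIC.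
apply: negligibleS nji => x [Xox X'x]; split=> // Xix; apply: nIo.
suff -> : o = i by [].
by apply: Xtriv; [left|right|exists x].
Qed.

(** Each component overlaps exactly one component of the other decomposition
    in positive measure. Overlapping is a symmetric relation, so the resulting
    maps between the index sets are inverse to each other. *)
Lemma decomposition_bijection : exists pi : J -> J',
  set_bij I I' pi /\ (forall i, I i -> eq_mod_null mu (X' (pi i)) (X i)).
Proof.
have [_ _ _ Xcomp] := dec; have [_ _ _ X'comp] := dec'.
have /choice[pi pi_] i : exists j, I i -> I' j /\ ~ null (X i `&` X' j).
  have [Ii|nIi] := pselect (I i); last by exists o'.
  by have [j ? ?] := component_meets_part dec' (Xcomp i Ii); exists j.
exists pi; split; last first.
  move=> i Ii; have [I'j meet] := pi_ i Ii.
  have [nij nji] := components_eq_mod_null (Xcomp i Ii) (X'comp _ I'j) meet.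
  apply: eq_mod_nullI => //.
    exact: connected_meas (X'comp _ I'j).1.
  exact: connected_meas (Xcomp i Ii).1.
split.
- by move=> i /pi_[].
- move=> i1 i2; rewrite !inE => Ii1 Ii2 eqpi.
  have [I'j meet1] := pi_ i1 Ii1; have [_ meet2] := pi_ i2 Ii2.
  apply: (component_meets_one_part dec (X'comp _ I'j)) => //.
    by rewrite setIC.
  by rewrite eqpi setIC.
- move=> j I'j; have [i Ii meet] := component_meets_part dec (X'comp j I'j).
  exists i => //; have [I'pi meetpi] := pi_ i Ii.
  apply: (component_meets_one_part dec' (Xcomp i Ii)) => //.
  by rewrite setIC.
Qed.

End TwoDecompositions.

End Connected.

Theorem theorem2p2 (d : measure_display) (T : measurableType d) (R : realType)
    (mu : probability T R) (Gamma : T * T -> R) (hGamma : is_digraphon Gamma) :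
  (exists (I : set nat) (X : nat -> set T),
     component_decomposition mu Gamma [set set0] 0%N I X) /\
  (forall (J J' : Type) (o : J) (o' : J') (I : set J) (I' : set J')
     (X : J -> set T) (X' : J' -> set T),
     component_decomposition mu Gamma (nullset mu) o I X ->
     component_decomposition mu Gamma (nullset mu) o' I' X' ->
     (exists pi : J -> J',
        set_bij I I' pi /\
        (forall i, I i -> eq_mod_null mu (X' (pi i)) (X i))) /\
     eq_mod_null mu (X o) (X' o')).
Proof.
split; first exact: decomposition_exists.
move=> J J' o o' I I' X X' dec dec'; split.
  exact: decomposition_bijection dec dec'.
have [_ _ [mXo _] _] := dec; have [_ _ [mXo' _] _] := dec'.
by apply: eq_mod_nullI => //; apply: remainder_sub_mod_null; eassumption.
Qed.
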